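(* The group $2V$ is generated by the eight elements $\{A_i, B_i, \pi_i, \overline{\pi}_i \mid i=0,1\}$.
   Context: Let $C\subset I=[0,1]$ be the standard middle-thirds Cantor set. A pattern in a unit square is a finite set of rectangles obtained from the trivial pattern (the whole square) by finitely many steps, each replacing one rectangle by its two halves under a vertical or horizontal bisection. Each rectangle $R$ occurring in a pattern corresponds to a closed and open subset $A(R)$ of $C\times C$: the whole square corresponds to $C\times C$; the left and right halves of $R$ correspond to the left and right thirds of $A(R)$; the bottom and top halves of $R$ correspond to the bottom and top thirds of $A(R)$. For two patterns $P_1,P_2$ with the same number of rectangles, each numbered by $0,\ldots,n-1$, $h(P_1,P_2)$ is the self homeomorphism of $C\times C$ taking, for each $i$, the set of rectangle $i$ of $P_1$ onto the set of rectangle $i$ of $P_2$ by an affine map $(x,y)\mapsto(a+3^jx,b+3^ky)$ ($a,b\in\mathbf{R}$, $j,k\in\mathbf{Z}$). The group $2V$ is the group of all such $h(P_1,P_2)$ under composition. Let $S_0,S_1,\ldots$ be pairwise disjoint unit squares in the plane, each containing a copy of $C\times C$, and let $Y$ be the union of these copies. A numbered sequence of patterns is a sequence $(P_0,P_1,\ldots)$, $P_i$ a pattern in $S_i$, only finitely many $P_i$ nontrivial, with a bijection between $\mathbf{N}=\{0,1,2,\ldots\}$ and all the rectangles such that for some $j,k\in\mathbf{N}$, every $S_i$ with $i>k$ is undivided and is numbered $i+j$. It determines a homeomorphism $Y\to Y$ taking, for each $i$, the whole copy of $C\times C$ in $S_i$ onto the set corresponding to rectangle $i$, affinely and preserving orientation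 in each coordinate. The set of these homeomorphisms is a monoid $\Pi$ under composition (right to left: in $fg$, $g$ is applied first). Particular elements of $\Pi$, for $i\ge0$: $v_i$ is given by dividing only $S_i$, by a vertical bisection, numbering its left half $i$, its right half $i+1$, and $S_j$ by $j$ for $j<i$ and by $j+1$ for $j>i$; $h_i$ is given by dividing only $S_i$, by a horizontal bisection, numbering its lower half $i$, its upper half $i+1$, and $S_j$ by $j$ for $j<i$ and by $j+1$ for $j>i$; $\sigma_i$ is given by dividing no square, numbering $S_i$ by $i+1$, $S_{i+1}$ by $i$, and every other $S_j$ by $j$. For $a,b\in\Pi$ the pair $(a,b)$ denotes the homeomorphism $ab^{-1}$ of $Y$. The group $2V$ is regarded as a group of homeomorphisms of $Y$ by letting it act on the copy of $C\times C$ in $S_0$ and as the identity on all other copies. In this way the following are elements of $2V$, for $i\ge0$: $$A_i=(v_0^{i+1}v_1,\,v_0^{i+2}),\quad B_i=(v_0^{i+1}h_1,\,v_0^{i+2}),\quad \pi_i=(v_0^{i+2}\sigma_1,\,v_0^{i+2}),\quad \overline{\pi}_i=(v_0^{i+1}\sigma_0,\,v_0^{i+1}).$$ *)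

(* Defs.v *)
From HB Require Import structures.
From mathcomp Require Import all_boot all_order all_algebra.
From mathcomp Require Import mathcomp_extra boolp classical_sets functions.
From mathcomp Require Import cardinality reals topology normedtype.
From mathcomp Require Import ring lra zify.
Import Order.TTheory GRing.Theory Num.Theory numFieldNormedType.Exports.

Set Implicit Arguments.
Unset Strict Implicit.
Unset Printing Implicit Defensive.

Local Open Scope classical_set_scope.
Local Open Scope ring_scope.

(* The group law on self-homeomorphisms is composition from right to left: in *)
(* f * g, the map g is applied first.                                         *)

Record homeo (T : topologicalType) := Homeo {
  homeo_fun :> T -> T;
  homeo_inv : T -> T;
  homeoK : cancel homeo_fun homeo_inv;
  homeo_invK : cancel homeo_inv homeo_fun;
  homeo_continuous : continuous homeo_fun;
  homeo_inv_continuous : continuous homeo_inv }.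

Arguments homeo_continuous {T} h.
Arguments homeo_inv_continuous {T} h.

Section HomeoGroup.
Context {T : topologicalType}.
Implicit Types f g : homeo T.

Lemma homeoP f g : f =1 g -> f = g.
Proof.
case: f => f f' fK f'K fc f'c; case: g => g g' gK g'K gc g'c /= /funext fg.
move: fK f'K fc f'c; rewrite fg {f fg} => gK' f'K gc' f'c.
have f'g' : f' = g' by apply/funext => x; rewrite -{1}(g'K x) gK'.
move: gK' f'K gc' f'c; rewrite f'g' {f' f'g'} => gK' f'K gc' f'c.
by congr Homeo; exact: Prop_irrelevance.
Qed.

Definition homeo1 : homeo T :=
  @Homeo T id id (fun=> erefl) (fun=> erefl) (fun=> cvg_id) (fun=> cvg_id).

Definition homeoV f : homeo T :=
  Homeo (homeo_invK f) (homeoK f) (homeo_inv_continuous f) (homeo_continuous f).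

Lemma homeo_comp_subproof (f g : T -> T) :
  continuous f -> continuous g -> continuous (f \o g).
Proof. by move=> fc gc x; apply: continuous_comp; [exact: gc|exact: fc]. Qed.

Definition homeoM f g : homeo T :=
  Homeo (can_comp (homeoK f) (homeoK g))
        (can_comp (homeo_invK g) (homeo_invK f))
        (homeo_comp_subproof (homeo_continuous f) (homeo_continuous g))
        (homeo_comp_subproof (homeo_inv_continuous g) (homeo_inv_continuous f)).

Lemma homeoMA : associative homeoM. Proof. by move=> f g h; exact: homeoP. Qed.
Lemma homeo1M : left_id homeo1 homeoM. Proof. by move=> f; exact: homeoP. Qed.
Lemma homeoM1 : right_id homeo1 homeoM. Proof. by move=> f; exact: homeoP. Qed.
Lemma homeoVM : left_inverse homeo1 homeoV homeoM.
Proof. by move=> f; apply: homeoP => x /=; rewrite homeoK. Qed.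
Lemma homeoMV : right_inverse homeo1 homeoV homeoM.
Proof. by move=> f; apply: homeoP => x /=; rewrite homeo_invK. Qed.

End HomeoGroup.

HB.instance Definition _ (T : topologicalType) := gen_eqMixin (homeo T).
HB.instance Definition _ (T : topologicalType) := gen_choiceMixin (homeo T).
HB.instance Definition _ (T : topologicalType) := isGroup.Build (homeo T)
  homeoMA homeo1M homeoM1 homeoVM homeoMV.

Lemma homeo_ex (T : topologicalType) (f : T -> T) :
    injective f -> (forall y, exists x, f x = y) -> continuous f ->
    (forall x (U : set T), nbhs x U -> nbhs (f x) (f @` U)) ->
  exists g : homeo T, homeo_fun g = f.
Proof.
move=> f_inj f_surj f_cont f_open.
pose g y := sval (cid (f_surj y)).
have gK : cancel g f by move=> y; rewrite /g; case: cid.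
have fK : cancel f g by move=> x; apply: f_inj; rewrite gK.
have g_cont : continuous g.
  move=> y U /= Ugy; have := f_open _ _ Ugy; rewrite gK.
  by apply: filterS => _ [x Ux <-] /=; rewrite fK.
by exists (Homeo fK gK f_cont g_cont).
Qed.

Definition mk_homeo (T : topologicalType) (f : T -> T) (f_inj : injective f)
    (f_surj : forall y, exists x, f x = y) (f_cont : continuous f)
    (f_open : forall x (U : set T), nbhs x U -> nbhs (f x) (f @` U)) : homeo T :=
  sval (cid (homeo_ex f_inj f_surj f_cont f_open)).

Lemma mk_homeoE (T : topologicalType) (f : T -> T) f_inj f_surj f_cont f_open :
  homeo_fun (@mk_homeo T f f_inj f_surj f_cont f_open) = f.
Proof. by rewrite /mk_homeo; case: cid. Qed.

Lemma pair_continuous (S T U : topologicalType) (f : S -> T) (g : S -> U) :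
  continuous f -> continuous g -> continuous (fun x => (f x, g x)).
Proof.
move=> fc gc x W [[V1 V2] [/= fV1 gV2] VW].
have fx : nbhs x (f @^-1` V1) := fc x V1 fV1.
have gx : nbhs x (g @^-1` V2) := gc x V2 gV2.
by apply: filterS (filterI fx gx) => z [? ?]; exact: VW.
Qed.

Definition subgroup (G : groupType) (H : set G) : Prop :=
  [/\ H 1%g, forall x y, H x -> H y -> H (x * y)%g & forall x, H x -> H x^-1%g].

Definition generated (G : groupType) (S : set G) : set G :=
  smallest (@subgroup G) S.

(* The middle-thirds Cantor set. [third false] and [third true] are the       *)
(* affine maps from [0, 1] onto its left (bottom) and right (top) thirds.     *)

Definition third {R : realType} (b : bool) (x : R) : R :=
  if b then (2 + x) / 3 else x / 3.

Fixpoint cantor_stage {R : realType} (n : nat) : set R :=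
  if n is n'.+1 then
    third false @` cantor_stage n' `|` third true @` cantor_stage n'
  else [set x | 0 <= x <= 1].

Definition cantor_set {R : realType} : set R := \bigcap_n cantor_stage n.

Notation cantor R := (set_type (@cantor_set R)).
Notation cantor2 R := (cantor R * cantor R)%type.

Section Third.
Context {R : realType}.
Implicit Types (x y : R) (b : bool).

Lemma third_inj b : injective (@third R b).
Proof. by rewrite /third; case: b => x y h; lra. Qed.

Lemma cantor_set01 x : cantor_set x -> 0 <= x <= 1.
Proof. by move=> /(_ 0%N I). Qed.

Lemma cantor_set_third b x : cantor_set x -> cantor_set (third b x).
Proof.
move=> Cx [|n] _ /=.
  by have /andP[? ?] := cantor_set01 Cx; rewrite /third; case: b; lra.
by case: b; [right|left]; exists x => //; exact: Cx.
Qed.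

Lemma third_neq x y : 0 <= x <= 1 -> 0 <= y <= 1 -> third false x <> third true y.
Proof. by rewrite /third => /andP[? ?] /andP[? ?] ?; lra. Qed.

Lemma third_ball_eq b b' x y : 0 <= x <= 1 -> 0 <= y <= 1 ->
  ball (third b' y) (1 / 3) (third b x) -> b = b'.
Proof.
move=> /andP[? ?] /andP[? ?]; rewrite /ball /= ltr_distl /third => /andP[].
by case: b b' => -[] // ? ?; lra.
Qed.

Lemma cantor_stage01 n x : cantor_stage n x -> 0 <= x <= 1.
Proof.
elim: n x => [//|n IH] x /= [] [y /IH /andP[? ?] <-]; rewrite /third; lra.
Qed.

Lemma cantor_set_split y : cantor_set y ->
  exists b x, cantor_set x /\ third b x = y.
Proof.
move=> Cy; have [b [x [x01 bx]]] : exists b x, 0 <= x <= 1 /\ third b x = y.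
  by case: (Cy 1%N I) => -[x x01 <-]; [exists false, x|exists true, x].
exists b, x; split=> // n _.
case: (Cy n.+1 I) => -[z nz zy]; have z01 := cantor_stage01 nz.
  case: b bx => bx; first by case: (@third_neq z x) => //; rewrite zy.
  by rewrite (@third_inj false x z) // bx zy.
case: b bx => bx; last by case: (@third_neq x z) => //; rewrite zy.
by rewrite (@third_inj true x z) // bx zy.
Qed.

End Third.

Section CantorThird.
Context {R : realType}.
Implicit Types (x y : cantor R) (b : bool).

Definition cthird b (x : cantor R) : cantor R :=
  exist _ (third b (val x)) (mem_set (cantor_set_third b (set_mem (valP x)))).

Lemma cthird_inj b : injective (cthird b).
Proof. by move=> x y /(congr1 val)/third_inj; exact: val_inj. Qed.

Lemma cthird_neq x y : cthird false x <> cthird true y.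
Proof.
move=> /(congr1 val); apply: third_neq; apply: cantor_set01; exact: set_mem (valP _).
Qed.

Lemma cthird_eq b b' x y : cthird b x = cthird b' y -> b = b' /\ x = y.
Proof.
by case: b b' => -[] e; [split=> //; exact: cthird_inj e|
  case: (@cthird_neq y x)|case: (@cthird_neq x y)|split=> //; exact: cthird_inj e].
Qed.

Lemma cthird_split y : exists b x, cthird b x = y.
Proof.
have [b [x [Cx e]]] := cantor_set_split (set_mem (valP y)).
by exists b, (exist _ x (mem_set Cx)); exact: val_inj.
Qed.

Lemma nbhs_cantorE (x : cantor R) (U : set (cantor R)) :
  nbhs x U <-> exists2 W : set R, nbhs (val x) W & val @^-1` W `<=` U.
Proof.
split=> [|[W xW WU]].
  rewrite nbhsE => -[V [[W oW <-] Wx] VU].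
  by exists W => //; exact: open_nbhs_nbhs.
by apply: filterS WU _; exact: (@initial_continuous _ _ val x W xW).
Qed.

Lemma cthird_continuous b : continuous (cthird b).
Proof.
move=> x U /= /nbhs_cantorE[W bxW WU]; apply/nbhs_cantorE.
exists (third b @^-1` W); last by move=> y /= Wy; exact: WU.
suff /(_ _ bxW) : {for (val x : R), continuous (third b)} by [].
rewrite /third; case: b {bxW WU} => /=.
  by apply: cvgMr_tmp; apply: cvgD; [exact: cvg_cst|exact: cvg_id].
by apply: cvgMr_tmp; exact: cvg_id.
Qed.

Lemma cthird_open b x (U : set (cantor R)) :
  nbhs x U -> nbhs (cthird b x) (cthird b @` U).
Proof.
move=> /nbhs_cantorE[W xW WU]; apply/nbhs_cantorE.
pose u (y : R) : R := if b then 3 * y - 2 else 3 * y.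
have uK : cancel (third b) u.
  by rewrite /u /third => y; case: (b) => /=; field.
exists (u @^-1` W `&` ball (third b (val x)) (1 / 3)); last first.
  move=> y [Wuy By]; have [b' [z yz]] := cthird_split y.
  have bb' : b' = b.
    apply: (@third_ball_eq _ _ _ (val z) (val x)).
    - exact: (cantor_set01 (set_mem (valP z))).
    - exact: (cantor_set01 (set_mem (valP x))).
    - by move: By; rewrite -yz.
  exists z; last by rewrite -bb'.
  by apply: WU; rewrite /= -(uK (val z)); move: Wuy; rewrite -yz bb'.
apply: filterI; last by apply: nbhsx_ballx; lra.
have : {for third b (val x), continuous u}.
  rewrite /u; case: (b) => /=.
    by apply: cvgB; [apply: cvgMl_tmp; exact: cvg_id|exact: cvg_cst].
  by apply: cvgMl_tmp; exact: cvg_id.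
by apply; rewrite uK.
Qed.

End CantorThird.

(* A rectangle obtained by repeated bisection is recorded by its address      *)
(* (u, w): the successive choices left (false) or right (true) made in the    *)
(* vertical bisections, and bottom (false) or top (true) in the horizontal    *)
(* ones, both in the order of the bisections. The relative order of vertical  *)
(* and horizontal bisections does not affect the resulting rectangle.         *)

Definition rect := (seq bool * seq bool)%type.

Definition whole : rect := ([::], [::]).

Variant bisection := Vertical | Horizontal.

Definition half (d : bisection) (b : bool) (r : rect) : rect :=
  match d with
  | Vertical => (rcons r.1 b, r.2)
  | Horizontal => (r.1, rcons r.2 b)
  end.

Inductive pattern : set rect -> Prop :=
| PatternWhole : pattern [set whole]
| PatternBisect (P : set rect) (r : rect) (d : bisection) :
    pattern P -> P r ->
    pattern (P `\ r `|` [set half d false r; half d true r]).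

(* [place r] is the affine, orientation-preserving map of C x C onto A(r):    *)
(* prolonging the address by b precomposes with the map onto a third.         *)

Definition place1 {R : realType} (u : seq bool) (x : cantor R) : cantor R :=
  foldr cthird x u.

Definition place {R : realType} (r : rect) (p : cantor2 R) : cantor2 R :=
  (place1 r.1 p.1, place1 r.2 p.2).

Definition region {R : realType} (r : rect) : set (cantor2 R) := range (place r).

Definition third2 {R : realType} (d : bisection) (b : bool) (p : cantor2 R) :
    cantor2 R :=
  match d with
  | Vertical => (cthird b p.1, p.2)
  | Horizontal => (p.1, cthird b p.2)
  end.

Section Place.
Context {R : realType}.
Implicit Types (p q : cantor2 R) (r : rect) (u : seq bool).

Lemma place_half d b r p : place (half d b r) p = place r (third2 d b p).
Proof. by case: d; rewrite /place /place1 /= foldr_rcons. Qed.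

Lemma third2_split d p : exists b q, third2 d b q = p.
Proof.
case: d p => -[x y] /=.
  by have [b [z <-]] := cthird_split x; exists b, (z, y).
by have [b [z <-]] := cthird_split y; exists b, (x, z).
Qed.

Lemma third2_eq d b b' p q : third2 d b p = third2 d b' q -> b = b' /\ p = q.
Proof.
case: d p q => -[x y] [x' y'] /= e.
  by have [/cthird_eq[-> ->] /= <-] := (congr1 fst e, congr1 snd e).
by have [/= <- /cthird_eq[-> ->]] := (congr1 fst e, congr1 snd e).
Qed.

Lemma place_inj r : injective (@place R r).
Proof.
have inj1 u : injective (@place1 R u).
  by elim: u => [//|b u IH] x y /= /cthird_inj /IH.
move=> [x y] [x' y'] e.
by have [/inj1 /= -> /inj1 /= ->] := (congr1 fst e, congr1 snd e).
Qed.

Lemma place_continuous r : continuous (@place R r).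
Proof.
have cont1 u : continuous (@place1 R u).
  elim: u => [|b u IH] x; first exact: cvg_id.
  by apply: (@continuous_comp _ _ _ (place1 u) (cthird b));
    [exact: IH|exact: cthird_continuous].
apply: pair_continuous => p.
  by apply: (@continuous_comp _ _ _ fst (place1 r.1)); [exact: cvg_fst|exact: cont1].
by apply: (@continuous_comp _ _ _ snd (place1 r.2)); [exact: cvg_snd|exact: cont1].
Qed.

Lemma place_open r p (U : set (cantor2 R)) :
  nbhs p U -> nbhs (place r p) (place r @` U).
Proof.
have open1 u (x : cantor R) (V : set (cantor R)) :
    nbhs x V -> nbhs (place1 u x) (place1 u @` V).
  elim: u => [|b u IH] xV /=; first by rewrite image_id.
  have := cthird_open b (IH xV); apply: filterS => _ [_ [y Vy <-] <-].
  by exists y.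
move=> -[[V W] [xV yW] VWU].
exists (place1 r.1 @` V, place1 r.2 @` W); first by split; exact: open1.
move=> [_ _] /= [[x Vx <-] [y Wy <-]]; exists (x, y) => //; exact: VWU.
Qed.

Lemma pattern_cover (P : set rect) p : pattern P -> exists2 r, P r & region r p.
Proof.
move=> PP; elim: PP => {P} [|P r d _ [r' Pr' pr'] Pr].
  by exists whole => //; exists p => //; case: p.
have [rr'|rr'] := pselect (r' = r); last by exists r' => //; left; split.
case: pr' => q _ qp; have [b [q' q'q]] := third2_split d q.
exists (half d b r); first by right; case: (b); [right|left].
by exists q' => //; rewrite place_half q'q -rr'.
Qed.

Lemma pattern_disjoint (P : set rect) r r' p :
  pattern P -> P r -> P r' -> region r p -> region r' p -> r = r'.
Proof.
move=> PP; elim: PP r r' => {P} [|P r0 d _ IH Pr0] r r'; first by move=> -> ->.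
have key s : ((P `\ r0) `|` [set half d false r0; half d true r0]) s ->
    region s p -> [/\ P s, region s p & s <> r0] \/
    exists b q, s = half d b r0 /\ place r0 (third2 d b q) = p.
  by move=> [[Ps sr0]|[]->] [q _ <-]; [left; split=> //; exists q|
    right; exists false, q; rewrite place_half|
    right; exists true, q; rewrite place_half].
move=> /key kr /key kr' /kr{}kr /kr'{}kr'.
case: kr kr' => [[Pr rp rr0]|[b [q [-> qp]]]] [[Pr' rp' rr0']|[b' [q' [-> qp']]]].
- exact: IH.
- by case: rr0; apply: IH => //; exists (third2 d b' q').
- by case: rr0'; apply: IH => //; exists (third2 d b q).
- by move: qp; rewrite -qp' => /place_inj/third2_eq[->].
Qed.

End Place.

(* [num i] is the rectangle numbered i, with P as its set of values.          *)

Definition numbering (I : Type) (A : Type) (P : set A) (num : I -> A) : Prop :=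
  set_bij [set: I] P num.

(* f = h(P1, P2), for the numberings r1 of P1 and r2 of P2. *)
Definition is_h {R : realType} n (r1 r2 : 'I_n -> rect)
    (f : homeo (cantor2 R)) : Prop :=
  forall i, f @` region (r1 i) = region (r2 i) /\
    exists (a b : R) (j k : int), forall p, region (r1 i) p ->
      val (f p).1 = a + 3 ^ j * val p.1 /\ val (f p).2 = b + 3 ^ k * val p.2.

Definition twoV {R : realType} : set (homeo (cantor2 R)) :=
  [set f | exists n (P1 P2 : set rect) (r1 r2 : 'I_n -> rect),
    [/\ pattern P1, pattern P2, numbering P1 r1, numbering P2 r2 & is_h r1 r2 f]].

(* Y is the disjoint union of copies of C x C indexed by nat; (i, p) is the   *)
(* point with coordinates p in the unit square S_i.                           *)

Notation Yspace R := (nat * cantor2 R)%type.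

Section NatProduct.
Context {T : topologicalType}.

Lemma nbhs_natprod (i : nat) (p : T) (U : set (nat * T)) :
  nbhs (i, p) U <-> nbhs p [set q | U (i, q)].
Proof.
split=> [[[V W] /= [iV pW] VWU]|pU].
  by apply: filterS pW => q Wq; apply: VWU; split=> //=; exact: nbhs_singleton iV.
exists ([set i], [set q | U (i, q)]) => /=; last by move=> [j q] /= [-> ].
by split=> //; rewrite nbhs_principalE; exact/principal_filterP.
Qed.

Lemma natprod_continuous (Z : topologicalType) (f : nat * T -> Z) :
  (forall i, continuous (fun p => f (i, p))) -> continuous f.
Proof. by move=> fc [i p] U fU; apply/nbhs_natprod; exact: fc. Qed.

Definition on_S0_fun (f : T -> T) (y : nat * T) : nat * T :=
  (y.1, if y.1 is 0%N then f y.2 else y.2).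

Lemma on_S0_continuous (f : T -> T) : continuous f -> continuous (on_S0_fun f).
Proof.
move=> fc; apply: natprod_continuous => -[|i].
  by apply: pair_continuous; [exact: cst_continuous|exact: fc].
by apply: pair_continuous; [exact: cst_continuous|move=> x; exact: cvg_id].
Qed.

Lemma on_S0K (f g : T -> T) : cancel f g -> cancel (on_S0_fun f) (on_S0_fun g).
Proof. by move=> fK [[|i] p]; rewrite /on_S0_fun //= fK. Qed.

Definition on_S0 (f : homeo T) : homeo (nat * T)%type :=
  Homeo (on_S0K (homeoK f)) (on_S0K (homeo_invK f))
    (on_S0_continuous (homeo_continuous f))
    (on_S0_continuous (homeo_inv_continuous f)).

End NatProduct.

Definition twoV_Y {R : realType} : set (homeo (Yspace R)) := on_S0 @` twoV.

(* [num n] is the pair of an index i and a rectangle in S_i. *)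
Record numbered_patterns := NumberedPatterns {
  pat : nat -> set rect;
  num : nat -> nat * rect;
  pat_pattern : forall i, pattern (pat i);
  num_numbering : numbering [set q | pat q.1 q.2] num;
  num_tail : exists j k : nat, forall i, (k < i)%N ->
    pat i = [set whole] /\ num (i + j)%N = (i, whole) }.

Section PiMap.
Context {R : realType} (s : numbered_patterns).

Definition Pi_fun (y : Yspace R) : Yspace R :=
  ((num s y.1).1, place (num s y.1).2 y.2).

Lemma Pi_fun_inj : injective Pi_fun.
Proof.
have [numP numI _] := num_numbering s.
move=> [i p] [j q] e.
have ij : (num s i).1 = (num s j).1 := congr1 fst e.
have pq : place (num s i).2 p = place (num s j).2 q := congr1 snd e.
have ij' : num s i = num s j.
  rewrite [num s i]surjective_pairing [num s j]surjective_pairing ij.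
  congr pair; apply: (pattern_disjoint (pat_pattern s (num s j).1)
    (p := place (num s j).2 q)).
  - by rewrite -ij; exact: (numP i I).
  - exact: (numP j I).
  - by rewrite -pq; exists p.
  - by exists q.
have eij : i = j by apply: numI => //; rewrite in_setE.
by move: pq; rewrite eij => /place_inj->.
Qed.

Lemma Pi_fun_surj y : exists x, Pi_fun x = y.
Proof.
have [_ _ numS] := num_numbering s.
case: y => i p; have [r ir [q _ qp]] := pattern_cover p (pat_pattern s i).
by have [n _ nE] := numS (i, r) ir; exists (n, q); rewrite /Pi_fun nE /= qp.
Qed.

Lemma Pi_fun_continuous : continuous Pi_fun.
Proof.
apply: natprod_continuous => i.
apply: (@pair_continuous _ _ _ (fun=> (num s i).1) (place (num s i).2)).
  exact: cst_continuous.
exact: place_continuous.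
Qed.

Lemma Pi_fun_open y (U : set (Yspace R)) : nbhs y U -> nbhs (Pi_fun y) (Pi_fun @` U).
Proof.
case: y => i p /nbhs_natprod /(place_open (num s i).2) pU.
apply/nbhs_natprod; apply: filterS pU => _ [q Uq <-].
by exists (i, q).
Qed.

(* The homeomorphism determined by s: the whole copy of C x C in S_i goes to  *)
(* the region of the rectangle numbered i. The monoid Pi is the range of      *)
(* [Pi_homeo].                                                                *)
Definition Pi_homeo : homeo (Yspace R) :=
  mk_homeo Pi_fun_inj Pi_fun_surj Pi_fun_continuous Pi_fun_open.

Lemma Pi_homeoE : homeo_fun Pi_homeo = Pi_fun.
Proof. exact: mk_homeoE. Qed.

End PiMap.
Arguments Pi_homeo R s : clear implicits.

(* S_i alone is bisected, in direction d; its left or lower half is numbered  *)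
(* i and the other one i + 1.                                                 *)

Definition bisect_pat (d : bisection) (i j : nat) : set rect :=
  if j == i then [set half d false whole; half d true whole] else [set whole].

Definition bisect_num (d : bisection) (i n : nat) : nat * rect :=
  if (n < i)%N then (n, whole)
  else if n == i then (i, half d false whole)
  else if n == i.+1 then (i, half d true whole)
  else (n.-1, whole).

Lemma bisect_pattern d i j : pattern (bisect_pat d i j).
Proof.
rewrite /bisect_pat; case: eqP => _; last exact: PatternWhole.
have -> : [set half d false whole; half d true whole] =
    [set whole] `\ whole `|` [set half d false whole; half d true whole].
  by rewrite setDv set0U.
exact: PatternBisect PatternWhole _.
Qed.

Lemma bisect_numbering d i :
  numbering [set q | bisect_pat d i q.1 q.2] (bisect_num d i).
Proof.
split.
- move=> n _; rewrite /bisect_pat /bisect_num /=.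
  case: (ltnP n i) => [ni|ni] /=; first by rewrite ltn_eqF.
  case: (eqVneq n i) => [_|ni'] /=; first by rewrite eqxx; left.
  case: (eqVneq n i.+1) => [_|ni''] /=; first by rewrite eqxx; right.
  by case: eqP => // ?; lia.
- move=> m n _ _; rewrite /bisect_num.
  case: ltnP => ?; case: ltnP => ?; do ?case: eqP => ?; case: (d) => /= e;
    by [discriminate e|move: (congr1 fst e) => /= ?; lia].
- move=> [j r] /=; rewrite /bisect_pat /bisect_num; case: eqP => [->|ji].
    by move=> [] ->; [exists i|exists i.+1] => //;
      rewrite ?ltnn ?eqxx // ltnNge leqnSn /= eqn_leq ltnn /=.
  move=> ->; have [lji|lij] := ltnP j i; first by exists j => //; rewrite lji.
  exists j.+1 => //; rewrite ltnNge (leq_trans lij) //=.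
  by do 2 (case: eqP => ?; first lia).
Qed.

Lemma bisect_tail d i : exists j k : nat, forall n, (k < n)%N ->
  bisect_pat d i n = [set whole] /\ bisect_num d i (n + j)%N = (n, whole).
Proof.
exists 1%N, i => n ni; rewrite /bisect_pat /bisect_num addn1.
split; first by case: eqP => //; lia.
rewrite ltnNge (leq_trans (ltnW ni)) //=.
by do 2 (case: eqP => ?; first lia).
Qed.

Definition bisect_at d i : numbered_patterns :=
  NumberedPatterns (bisect_pattern d i) (bisect_numbering d i) (bisect_tail d i).

(* No square is divided; the numbers of S_i and S_(i+1) are exchanged. *)

Definition swap_num (i n : nat) : nat * rect :=
  (if n == i then i.+1 else if n == i.+1 then i else n, whole).

Lemma swap_numbering i : numbering [set q | [set whole] q.2] (swap_num i).
Proof.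
split.
- by [].
- move=> m n _ _ /(congr1 fst) /=.
  by case: (m =P i); case: (m =P i.+1); case: (n =P i); case: (n =P i.+1) => *; lia.
- move=> [j r] /= ->; exists (swap_num i j).1 => //.
  rewrite /swap_num /=; congr pair.
  case: (j =P i) => [->|ji]; first by case: eqP => ?; rewrite ?eqxx //; lia.
  case: (j =P i.+1) => [->|ji']; first by rewrite eqxx.
  by do 2 (case: eqP => // _).
Qed.

Lemma swap_tail i : exists j k : nat, forall n, (k < n)%N ->
  [set whole] = [set whole] /\ swap_num i (n + j)%N = (n, whole).
Proof.
exists 0%N, i.+1 => n ni; split=> //; rewrite /swap_num addn0.
by do 2 (case: eqP => ?; first lia).
Qed.

Definition swap_at i : numbered_patterns :=
  @NumberedPatterns (fun=> [set whole]) (swap_num i) (fun=> PatternWhole)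
    (swap_numbering i) (swap_tail i).

(* The pair (a, b) of elements of Pi is a / b, that is, a * b^-1. *)

Section Generators.
Context (R : realType).
Local Open Scope group_scope.

Definition v (i : nat) : homeo (Yspace R) := Pi_homeo R (bisect_at Vertical i).
Definition h (i : nat) : homeo (Yspace R) := Pi_homeo R (bisect_at Horizontal i).
Definition sigma (i : nat) : homeo (Yspace R) := Pi_homeo R (swap_at i).

Definition A (i : nat) : homeo (Yspace R) := (v 0 ^+ i.+1 * v 1) / v 0 ^+ i.+2.
Definition B (i : nat) : homeo (Yspace R) := (v 0 ^+ i.+1 * h 1) / v 0 ^+ i.+2.
Definition pi_ (i : nat) : homeo (Yspace R) :=
  (v 0 ^+ i.+2 * sigma 1) / v 0 ^+ i.+2.
Definition pibar (i : nat) : homeo (Yspace R) :=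
  (v 0 ^+ i.+1 * sigma 0) / v 0 ^+ i.+1.

End Generators.

(* Main.v *)
From mathcomp Require Import all_boot all_order all_algebra.
From mathcomp Require Import boolp classical_sets functions.
From mathcomp Require Import reals topology normedtype.
From mathcomp Require Import ring lra zify.
Require Import Defs.
Import Order.TTheory GRing.Theory Num.Theory numFieldNormedType.Exports.

Set Implicit Arguments.
Unset Strict Implicit.
Unset Printing Implicit Defensive.

Local Open Scope classical_set_scope.

(** Write v for v_0, and call m-word a product of bisections and transpositions
    acting on the squares S_0, ..., S_m, where m counts the bisections made so
    far. Such a word cuts S_0 alone, into m + 1 numbered rectangles, and shifts
    the other squares down by m.

    The inclusion of 2V in the generated group. Every numbered pattern with
    m + 1 rectangles is realised by an m-word ([pattern_spelled]; adjacent
    transpositions reach every numbering, [spells_perm]). If f carries the i-th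
    rectangle of a pattern to the i-th rectangle of another, and the words g1, g2
    realise the two patterns, then f = g2 g1^-1 = (g2 v^-m) (g1 v^-m)^-1
    ([on_S0_spelled]). So it is enough that g v^-m is generated for every m-word
    g. Inserting v^-k v^k between consecutive letters turns g v^-m into a product
    of factors v^m x_j v^-(m+1) with x a bisection and j <= m, and
    v^m sigma_j v^-m with j < m ([vfrac_word_gen]). Since x_j v = v x_(j+1) for
    j > 0, lowering the index reduces these factors to A_i, B_i, pi_i and the
    elements with j = 0, and conjugation by A_0 raises i by one as soon as
    i >= 1, which is why i = 0, 1 are enough ([vfrac_succ]). The elements with
    j = 0 are the pibar_i, the identity, and v^m h_0 v^-(m+1). The last is
    reached from h_1 by transpositions if m > 0 ([bis_swap]). The case m = 0, the
    first cut of S_0, has no neighbouring rectangle to use instead; there the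
    relation saying that a square can be cut into quarters starting with either
    direction ([bis_cross]) brings the first cut back to the vertical one.

    The converse inclusion. The generators are quotients of two m-words, which
    visibly lie in 2V ([word_quotient]); the work is to see that 2V is closed
    under composition ([twoVM]). An element of 2V that maps a pattern P onto P'
    may be refined along P, the image of any refinement of P being a refinement
    of P'. Every pattern refines to the grid of all rectangles whose two
    addresses have length N, for N large ([maps_pattern_grid]), so the target
    pattern of the first map and the source pattern of the second can both be
    taken to be the same grid. *)

(** * Homeomorphisms of Y given by a rectangle for each square *)

(** Addresses relative to r: the rectangle that sits in r as q sits in the whole
    square. *)
Definition extend (r q : rect) : rect := (r.1 ++ q.1, r.2 ++ q.2).

Lemma extendA r q s : extend r (extend q s) = extend (extend r q) s.
Proof. by rewrite /extend /= !catA. Qed.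

Lemma extend_whole r : extend r whole = r.
Proof. by case: r => u w; rewrite /extend /= !cats0. Qed.

Lemma half_extend d b r : half d b r = extend r (half d b whole).
Proof. by case: d r => -[u w]; rewrite /extend /= ?cats0 ?cats1. Qed.

Section Coding.
Context {R : realType}.
Implicit Types (nu mu : nat -> nat * rect) (f g : homeo (Yspace R)).

Lemma place_extend r q (p : cantor2 R) :
  place (extend r q) p = place r (place q p).
Proof. by rewrite /place /place1 /= !foldr_cat. Qed.

(** The common shape of the elements of the monoid Pi: a code tells which
    rectangle of which square each S_i is sent onto. Equalities in Pi become
    equalities of codes, which are arithmetic. *)
Definition act nu (y : Yspace R) : Yspace R := ((nu y.1).1, place (nu y.1).2 y.2).

Definition coded g nu := g =1 act nu.

Definition code_mul nu mu n :=
  ((nu (mu n).1).1, extend (nu (mu n).1).2 (mu n).2).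

Lemma coded1 : coded 1%g (fun n => (n, whole)).
Proof. by move=> [n [p q]]. Qed.

Lemma codedM f g nu mu :
  coded f nu -> coded g mu -> coded (f * g)%g (code_mul nu mu).
Proof.
by move=> fnu gmu y; rewrite [LHS]/= gmu fnu /act /= place_extend.
Qed.

Lemma coded_eq f g nu mu : coded f nu -> coded g mu -> nu =1 mu -> f = g.
Proof. by move=> fnu gmu e; apply: homeoP => y; rewrite fnu gmu /act e. Qed.

Definition bis d i : homeo (Yspace R) := Pi_homeo R (bisect_at d i).

Lemma coded_bis d i : coded (bis d i) (bisect_num d i).
Proof. by move=> y; rewrite Pi_homeoE. Qed.

Lemma coded_sigma i : coded (sigma R i) (swap_num i).
Proof. by move=> y; rewrite Pi_homeoE. Qed.

(* Conditions are decided from the innermost outwards, so that the condition of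
   an outer test is an arithmetic formula when its turn comes. *)
Ltac code_cases :=
  rewrite /code_mul /bisect_num /swap_num;
  repeat match goal with |- context [if ?b then _ else _] =>
    lazymatch b with
    | context [if _ then _ else _] => fail
    | _ => case: (boolP b) => ? /=; try (exfalso; lia)
    end end;
  rewrite ?extend_whole /extend -?surjective_pairing /=; try done; congr pair; lia.

Ltac codes := first [apply: coded_bis|apply: coded_sigma|apply: codedM; codes].
Ltac by_codes := eapply coded_eq; [codes|codes|move=> n; code_cases].

(** Cutting S_j renumbers S_i as S_(i+1) for i > j, so anything done to S_i
    afterwards can be done to S_(i+1) beforehand. *)
Lemma bis_bis d e i j : (j < i)%N ->
  (bis d i * bis e j = bis e j * bis d i.+1)%g.
Proof. by move=> ji; by_codes. Qed.

Lemma sigma_bis e i j : (j < i)%N ->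
  (sigma R i * bis e j = bis e j * sigma R i.+1)%g.
Proof. by move=> ji; by_codes. Qed.

Lemma bis_sigma d i j : (j.+1 < i)%N ->
  (bis d i * sigma R j = sigma R j * bis d i)%g.
Proof. by move=> ji; by_codes. Qed.

(** Cutting S_i amounts to cutting its neighbour, up to exchanging the two squares
    and permuting cyclically the numbers i, i + 1, i + 2. *)
Lemma bis_swap d i :
  bis d i = (sigma R i * bis d i.+1 * sigma R i * sigma R i.+1)%g.
Proof. by_codes. Qed.

(** Both sides cut S_i into quarters; the two orders number the quarters
    differently, in the two middle places. *)
Lemma bis_cross i :
  (bis Horizontal i * bis Vertical i.+1 * bis Vertical i =
   bis Vertical i * bis Horizontal i.+1 * bis Horizontal i * sigma R i.+1)%g.
Proof. by_codes. Qed.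

End Coding.

(** * Words and the numbered patterns of the square S_0 *)

Section ListCode.
Context {R : realType}.
Implicit Types (g : homeo (Yspace R)) (s t : seq rect) (P : set rect).

Lemma cantor_set_end (b : bool) : @cantor_set R (b%:R)%R.
Proof.
move=> n _; elim: n => [|n IH] /=; first by case: b; rewrite ?lexx ler01.
by case: b IH => IH; [right; exists 1%R|left; exists 0%R] => //;
  rewrite /third /=; lra.
Qed.

Definition cantor_end (b : bool) : cantor R :=
  exist _ (b%:R : R)%R (mem_set (cantor_set_end b)).

(** The region of a half is inside the region of the rectangle, whereas distinct
    rectangles of a pattern have disjoint regions. *)
Lemma half_notin P d b r : pattern P -> P r -> ~ P (half d b r).
Proof.
move=> PP Pr Pd; pose p : cantor2 R := (cantor_end false, cantor_end false).
have e : half d b r = r.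
  apply: (@pattern_disjoint R P _ _ (place (half d b r) p) PP Pd Pr).
    by exists p.
  by exists (third2 d b p); rewrite // place_half.
move/(congr1 (fun q : rect => (size q.1 + size q.2)%N)): e.
by case: (d) => /=; rewrite size_rcons; lia.
Qed.

(** The list s numbers the rectangles that S_0 is cut into; S_1, S_2, ... stay
    undivided and take the numbers from [size s] on. *)
Definition list_code s n : nat * rect :=
  if (n < size s)%N then (0%N, nth whole s n) else ((n - (size s).-1)%N, whole).

Lemma list_code_left s1 r s2 n : (n < size s1)%N ->
  list_code (s1 ++ r :: s2) n = (0%N, nth whole s1 n).
Proof. by move=> ns; rewrite /list_code nth_cat ns size_cat ltn_addr. Qed.

Lemma list_code_right s1 r s2 k :
  list_code (s1 ++ r :: s2) (size s1 + k) = list_code (r :: s2) k.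
Proof.
have e : (size s1 + k < size s1)%N = false by lia.
rewrite /list_code nth_cat e addKn size_cat ltn_add2l /=.
by case: ifP => //= _; congr pair; lia.
Qed.

Lemma list_code_bis s1 r s2 d :
  code_mul (list_code (s1 ++ r :: s2)) (bisect_num d (size s1)) =1
  list_code (s1 ++ half d false r :: half d true r :: s2).
Proof.
move=> n; rewrite /code_mul /bisect_num.
have [ns|sn] /= := ltnP n (size s1).
  by rewrite !list_code_left //= extend_whole.
rewrite -(subnKC sn) list_code_right; case: (n - size s1)%N => [|[|k]].
- by rewrite addn0 eqxx -[size s1]addn0 list_code_right /= -half_extend.
- by rewrite addn1 eqn_leq ltnn eqxx -[size s1]addn0 list_code_right /= -half_extend.
- do 2 (rewrite ifF; last lia); rewrite /= addnS /= list_code_right.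
  by rewrite extend_whole -surjective_pairing.
Qed.

Lemma list_code_sigma s1 r r' s2 :
  code_mul (list_code (s1 ++ r :: r' :: s2)) (swap_num (size s1)) =1
  list_code (s1 ++ r' :: r :: s2).
Proof.
move=> n; rewrite /code_mul /swap_num /= extend_whole -surjective_pairing.
have [ns|sn] := ltnP n (size s1).
  by do 2 (rewrite ifF; last lia); rewrite !list_code_left.
rewrite -(subnKC sn) list_code_right; case: (n - size s1)%N => [|[|k]].
- by rewrite addn0 eqxx -[(size s1).+1]addn1 list_code_right.
- by rewrite addn1 eqn_leq ltnn eqxx -[size s1]addn0 list_code_right.
- by do 2 (rewrite ifF; last lia); rewrite list_code_right.
Qed.

End ListCode.

Section Words.
Context {R : realType}.
Implicit Types (g : homeo (Yspace R)) (s t : seq rect) (P : set rect).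

(** The index is the number of bisections, so that m + 1 rectangles are available
    in S_0, and every letter acts on one of those. *)
Inductive word : nat -> homeo (Yspace R) -> Prop :=
| word_nil : word 0 1%g
| word_bis m g d j : (j <= m)%N -> word m g -> word m.+1 (g * bis d j)%g
| word_sigma m g j : (j.+1 <= m)%N -> word m g -> word m (g * sigma R j)%g.

Definition spells g s := word (size s).-1 g /\ coded g (list_code s).

Lemma coded_ext g nu mu : coded g nu -> nu =1 mu -> coded g mu.
Proof. by move=> gnu e y; rewrite gnu /act e. Qed.

Lemma coded_whole : coded (1%g : homeo (Yspace R)) (list_code [:: whole]).
Proof. by apply: coded_ext coded1 _ => -[|n]; rewrite /list_code. Qed.

Lemma spells_bis g s1 r s2 d : spells g (s1 ++ r :: s2) ->
  spells (g * bis d (size s1))%g (s1 ++ half d false r :: half d true r :: s2).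
Proof.
rewrite /spells !size_cat /= !addnS /= => -[wg cg]; split.
  by apply: word_bis; rewrite ?leq_addr.
exact: coded_ext (codedM cg (coded_bis _ _)) (list_code_bis _ _ _ _).
Qed.

Lemma spells_sigma g s1 r r' s2 : spells g (s1 ++ r :: r' :: s2) ->
  spells (g * sigma R (size s1))%g (s1 ++ r' :: r :: s2).
Proof.
rewrite /spells !size_cat /= !addnS /= => -[wg cg]; split.
  by apply: word_sigma; rewrite ?ltnS ?leq_addr.
exact: coded_ext (codedM cg (coded_sigma _)) (list_code_sigma _ _ _ _).
Qed.

(** The first entry of the target list is moved to its place by adjacent
    transpositions; u holds the entries that are already in place. *)
Lemma spells_perm g s t : spells g s -> perm_eq s t -> exists g', spells g' t.
Proof.
suff key u : forall g s, spells g (u ++ s) -> perm_eq s t ->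
    exists g', spells g' (u ++ t) by move=> gs; exact: (key [::] g s).
elim: t u => [|r t IH] u {}g {}s gs st.
  by exists g; rewrite (perm_nilP st) in gs.
have [s1 [s2 es]] : exists s1 s2, s = s1 ++ r :: s2.
  have : r \in s by rewrite (perm_mem st) mem_head.
  by case/splitPr => s1 s2; exists s1, s2.
rewrite {}es in gs st.
have [g' g's] : exists g', spells g' (u ++ r :: s1 ++ s2).
  elim/last_ind: s1 s2 g {st} gs => [|s1 r' IHs] s2 g gs; first by exists g.
  rewrite cat_rcons; apply: IHs; rewrite catA; apply: spells_sigma.
  by rewrite -catA -cat_rcons; exact: gs.
have := IH (rcons u r) g' (s1 ++ s2); rewrite !cat_rcons; apply=> //.
by move: st; rewrite -cat1s perm_catCA perm_cons.
Qed.

Lemma uniq_bisect s1 r s2 d : pattern [set` s1 ++ r :: s2] ->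
  uniq (s1 ++ r :: s2) -> uniq (s1 ++ half d false r :: half d true r :: s2).
Proof.
move=> PP us.
have half_s b : half d b r \notin s1 ++ r :: s2.
  apply/negP => ds; apply: (@half_notin R _ d b r PP) => //=.
  by rewrite mem_cat mem_head orbT.
have neq : half d false r != half d true r.
  by apply/eqP; case: (d) => -[/rcons_inj[]].
have := us; rewrite (perm_uniq (_ : perm_eq _ (r :: s1 ++ s2))) /=; last first.
  by rewrite -cat1s perm_catCA.
move=> /andP[_ us12].
rewrite (perm_uniq (_ : perm_eq _ (half d false r :: half d true r :: s1 ++ s2))).
  have := half_s false; have := half_s true.
  rewrite !mem_cat !inE !negb_or => /and3P[h1 _ h2] /and3P[h3 _ h4] /=.
  by rewrite inE !mem_cat !negb_or neq h1 h2 h3 h4.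
by rewrite -[_ :: _ :: s2]/([:: _; _] ++ s2) perm_catCA.
Qed.

Lemma set_bisect s1 r s2 d : uniq (s1 ++ r :: s2) ->
  [set` s1 ++ half d false r :: half d true r :: s2] =
  [set` s1 ++ r :: s2] `\ r `|` [set half d false r; half d true r].
Proof.
rewrite cat_uniq /= negb_or -!andbA => /and5P[_ rs1 _ rs2 _].
apply/seteqP; split=> q /=; rewrite !mem_cat !inE.
  move=> /or4P[qs|/eqP->|/eqP->|qs]; [left|right; left|right; right|left] => //.
    by split; [rewrite qs|move=> qr; rewrite -qr qs in rs1].
  by split; [rewrite qs !orbT|move=> qr; rewrite -qr qs in rs2].
move=> [[/or3P[->//|/eqP//|->] _]|[->|->]]; by rewrite ?eqxx ?orbT.
Qed.

Lemma pattern_spelled P : pattern P ->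
  exists g s, [/\ spells g s, uniq s & P = [set` s]].
Proof.
move=> PP; elim: PP => {P} [|P r d PP [g [s [gs us Ps]]] Pr].
  exists 1%g, [:: whole]; split=> //; last first.
    by apply/seteqP; split=> q /=; rewrite inE => /eqP.
  split; first exact: word_nil.
  exact: coded_whole.
rewrite {}Ps /= in PP Pr *; case/splitPr: Pr gs us PP => s1 s2 gs us PP.
exists (g * bis d (size s1))%g, (s1 ++ half d false r :: half d true r :: s2).
split; [exact: spells_bis|exact: uniq_bisect|by rewrite set_bisect].
Qed.

Lemma word_pattern m g : word m g -> exists s,
  [/\ size s = m.+1, uniq s, pattern [set` s] & coded g (list_code s)].
Proof.
have split_at s j : (j < size s)%N ->
    exists s1 r s2, s = s1 ++ r :: s2 /\ size s1 = j.
  move=> js; exists (take j s), (nth whole s j), (drop j.+1 s).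
  by rewrite -drop_nth // cat_take_drop size_takel // ltnW.
elim=> {m g} [|m g d j jm wg [s [ss us Ps cg]]|m g j jm wg [s [ss us Ps cg]]].
- exists [:: whole]; split=> //.
    rewrite (_ : [set` _] = [set whole]); first exact: PatternWhole.
    by apply/seteqP; split=> q /=; rewrite inE => /eqP.
  exact: coded_whole.
- have [|s1 [r [s2 [es <-]]]] := split_at s j; first by rewrite ss ltnS.
  rewrite {}es in ss us Ps cg.
  exists (s1 ++ half d false r :: half d true r :: s2); split.
  + by move: ss; rewrite !size_cat /= => <-; rewrite addnS.
  + exact: uniq_bisect.
  + rewrite set_bisect //; apply: PatternBisect => //=.
    by rewrite mem_cat mem_head orbT.
  + exact: coded_ext (codedM cg (coded_bis _ _)) (list_code_bis _ _ _ _).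
- have [|s1 [r [s2 [es ej]]]] := split_at s j; first by rewrite ss ltnS ltnW.
  rewrite -{}ej in jm *.
  have [r' [s3 es2]] : exists r' s3, s2 = r' :: s3.
    case: s2 es => [es|r' s3]; last by exists r', s3.
    by move: ss jm; rewrite es size_cat /= addn1 => -[->]; rewrite ltnn.
  rewrite {}es {}es2 in ss us Ps cg.
  have st : perm_eq (s1 ++ r' :: r :: s3) (s1 ++ r :: r' :: s3).
    by rewrite perm_cat2l -[r' :: r :: s3]cat1s -(cat1s r) perm_catCA.
  exists (s1 ++ r' :: r :: s3); split.
  + by rewrite (perm_size st).
  + by rewrite (perm_uniq st).
  + rewrite (_ : [set` _] = [set` s1 ++ r :: r' :: s3]) //.
    by apply/seteqP; split=> q /=; rewrite (perm_mem st).
  + exact: coded_ext (codedM cg (coded_sigma _)) (list_code_sigma _ _ _ _).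
Qed.

End Words.

(** * Which fractions with powers of v_0 the generators produce *)

Section Fractions.
Context {R : realType}.
Local Open Scope group_scope.
Implicit Types (y z : homeo (Yspace R)).

(** The shape of all the generators. Fractions with a matching inner power
    multiply like fractions ([vfracM]), so such products can be computed in Pi. *)
Definition vfrac m y n : homeo (Yspace R) := v R 0 ^+ m * y / v R 0 ^+ n.

Lemma vfracM m n k y z : vfrac m y n * vfrac n z k = vfrac m (y * z) k.
Proof. by rewrite /vfrac !mulgA mulgVK -!mulgA. Qed.

Lemma vfracV m n y : (vfrac m y n)^-1 = vfrac n y^-1 m.
Proof. by rewrite /vfrac invgM invgK invgM mulgA. Qed.

Lemma vfrac_shift m n y z :
  y * v R 0 = v R 0 * z -> vfrac m.+1 z n.+1 = vfrac m y n.
Proof.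
by move=> yz; rewrite /vfrac !expgSr -!mulgA invgM (mulgA (v R 0) z) -yz !mulgA mulgK.
Qed.

Lemma vfrac_bis d j m : (0 < j <= m)%N ->
  vfrac m (bis d j) m.+1 = vfrac (m - j).+1 (bis d 1) (m - j).+2.
Proof.
elim: j m => [//|[_|j IH]] [//|m] jm; first by rewrite subSS subn0.
rewrite (@vfrac_shift _ _ (bis d j.+1)) ?IH ?subSS //; exact: bis_bis.
Qed.

Lemma vfrac_sigma j m : (0 < j < m)%N ->
  vfrac m (sigma R j) m = vfrac (m - j.+1).+2 (sigma R 1) (m - j.+1).+2.
Proof.
elim: j m => [//|[_ [//|[//|m]] _|j IH [//|m] jm]]; first by rewrite !subSS subn0.
rewrite (@vfrac_shift _ _ (sigma R j.+1)) ?IH ?subSS //; exact: sigma_bis.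
Qed.

Context (H : set (homeo (Yspace R))) (H_subgroup : subgroup H).
Context (H_gen :
  \bigcup_(i < 2) [set A R i; B R i; pi_ R i; pibar R i] `<=` H).

Let HM x y : H x -> H y -> H (x * y). Proof. by case: H_subgroup => _ + _; apply. Qed.
Let HV x : H x -> H x^-1. Proof. by case: H_subgroup => _ _; apply. Qed.

(** Conjugation by A_0: as v^k v_k v^-(k+1) = A_0 for every k > 0, the
    hypothesis that y exchanges v_n with v_m says that A_0 conjugates one fraction
    into the other. *)
Lemma vfrac_succ m n y : (0 < m)%N -> (0 < n)%N ->
  v R m * y = y * v R n -> H (vfrac m y n) -> H (vfrac m.+1 y n.+1).
Proof.
move=> m0 n0 e Hy.
have HA k : (0 < k)%N -> H (vfrac k (v R k) k.+1).
  move=> k0; rewrite (@vfrac_bis Vertical k k) ?k0 ?leqnn // subnn.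
  by apply: H_gen; exists 0 => //; do 3 left.
have -> : vfrac m.+1 y n.+1 =
    (vfrac m (v R m) m.+1)^-1 * vfrac m y n * vfrac n (v R n) n.+1.
  by rewrite -mulgA vfracM -e -(vfracM m m.+1) mulKg.
by apply: (HM _ (HA n n0)); apply: HM => //; apply: HV; exact: HA.
Qed.

(** The commutation needed to pass from i to i + 1 holds for i >= 1 only, which
    is why two starting values are taken from the generators. The same is true of
    the next two lemmas. *)
Lemma vfrac_bis1_gen d i : H (vfrac i.+1 (bis d 1) i.+2).
Proof.
have H01 j : (j < 2)%N -> H (vfrac j.+1 (bis d 1) j.+2).
  move=> j2; apply: H_gen; exists j => //.
  by case: d; [do 3 left|do 2 left; right].
elim: i => [|[_|i IH]]; [exact: H01|exact: H01|].
by apply: vfrac_succ => //; rewrite [LHS]bis_bis.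
Qed.

Lemma vfrac_sigma1_gen i : H (vfrac i.+2 (sigma R 1) i.+2).
Proof.
have H01 j : (j < 2)%N -> H (vfrac j.+2 (sigma R 1) j.+2).
  by move=> j2; apply: H_gen; exists j => //; left; right.
elim: i => [|[_|i IH]]; [exact: H01|exact: H01|].
by apply: vfrac_succ => //; rewrite [LHS]bis_sigma.
Qed.

Lemma vfrac_sigma0_gen i : H (vfrac i.+1 (sigma R 0) i.+1).
Proof.
have H01 j : (j < 2)%N -> H (vfrac j.+1 (sigma R 0) j.+1).
  by move=> j2; apply: H_gen; exists j => //; right.
elim: i => [|[_|i IH]]; [exact: H01|exact: H01|].
by apply: vfrac_succ => //; rewrite [LHS]bis_sigma.
Qed.

Lemma vfrac_sigma_gen j m : (j < m)%N -> H (vfrac m (sigma R j) m).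
Proof.
case: j m => [[//|m] _|j m jm]; first exact: vfrac_sigma0_gen.
rewrite vfrac_sigma ?jm //; exact: vfrac_sigma1_gen.
Qed.

Lemma vfrac_bis_gen d j m : (j <= m)%N -> H (vfrac m (bis d j) m.+1).
Proof.
have bis_pos k n : (0 < k <= n)%N -> H (vfrac n (bis d k) n.+1).
  by move=> kn; rewrite vfrac_bis //; exact: vfrac_bis1_gen.
case: j => [_|j jm]; last by apply: bis_pos.
case: d bis_pos => bis_pos; first by rewrite /vfrac -expgSr mulgV; case: H_subgroup.
have bis0_pos n : H (vfrac n.+1 (bis Horizontal 0) n.+2).
  have -> : vfrac n.+1 (bis Horizontal 0) n.+2 =
      vfrac n.+1 (sigma R 0) n.+1 * vfrac n.+1 (bis Horizontal 1) n.+2 *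
      vfrac n.+2 (sigma R 0) n.+2 * vfrac n.+2 (sigma R 1) n.+2.
    by rewrite !vfracM -bis_swap.
  by do ![exact: vfrac_sigma_gen|exact: bis_pos|apply: HM].
case: m => [|m]; last exact: bis0_pos.
(* Multiplying by A_0 on the right cuts both halves of S_0 vertically; the four
   quarters can then be cut out starting with the vertical direction. *)
have e : vfrac 0 (bis Horizontal 0) 1 * vfrac 1 (v R 1) 2 =
    vfrac 1 (bis Horizontal 1) 2 * vfrac 2 (bis Horizontal 0) 3 *
    vfrac 3 (sigma R 1) 3.
  have e0 : vfrac 0 (bis Horizontal 0) 1 * vfrac 1 (v R 1) 2 =
      vfrac 0 (bis Horizontal 0 * v R 1 * v R 0) 3.
    by rewrite vfracM /vfrac (expgSr _ 2) !mulgA mulgKA.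
  rewrite e0 [X in vfrac _ X _](bis_cross 0) !vfracM /vfrac.
  by rewrite expg0 expg1 mul1g !mulgA.
rewrite -[vfrac _ _ _](mulgK (vfrac 1 (v R 1) 2)) e.
apply: HM; last by apply: HV; exact: (vfrac_bis1_gen Vertical).
apply: HM; last exact: vfrac_sigma_gen.
by apply: HM; [exact: vfrac_bis1_gen|exact: bis0_pos].
Qed.

(** The powers of v between consecutive letters cancel, so the quotient of a word
    by v^m is a product of the factors treated above. *)
Lemma vfrac_word_gen m g : word m g -> H (vfrac 0 g m).
Proof.
elim=> {m g} [|m g d j jm _ Hg|m g j jm _ Hg].
- by rewrite /vfrac expg0 mulg1 mulgV; case: H_subgroup.
- by rewrite -(vfracM _ m); apply: HM => //; exact: vfrac_bis_gen.
- by rewrite -(vfracM _ m); apply: HM => //; exact: vfrac_sigma_gen.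
Qed.

End Fractions.

(** * Elements of 2V are the maps that carry a pattern to a pattern *)

Section Affine.
Local Open Scope ring_scope.
Context {R : realType}.
Implicit Types (f g : homeo (cantor2 R)) (r q : rect) (P Q : set rect).

Definition carries f r r' := forall p, f (place r p) = place r' p.

Lemma val_place1 u (x : cantor R) :
  val (place1 u x) = val (place1 u (cantor_end false)) + 3 ^- size u * val x.
Proof.
elim: u x => [|b u IH] x /=; first by rewrite expr0 invr1 mul1r add0r.
rewrite [LHS]/= IH /= exprS invfM; case: (b); rewrite /third; lra.
Qed.

(** An increasing map of one piece of the Cantor set onto another matches their end
    points, which determine an affine map. *)
Lemma affine_cantor_onto (a b c d : R) : 0 < b -> 0 < d ->
    (forall x : cantor R, exists y : cantor R, a + b * val x = c + d * val y) ->
    (forall y : cantor R, exists x : cantor R, a + b * val x = c + d * val y) ->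
  a = c /\ b = d.
Proof.
move=> b0 d0 into onto.
have in01 (x : cantor R) : 0 <= val x <= 1.
  exact: cantor_set01 (set_mem (valP x)).
have e0 : val (cantor_end false : cantor R) = 0 by [].
have e1 : val (cantor_end true : cantor R) = 1 by [].
have [y0 ey0] := into (cantor_end false).
have [y1 ey1] := into (cantor_end true).
have [x0 ex0] := onto (cantor_end false).
have [x1 ex1] := onto (cantor_end true).
rewrite e0 ?e1 mulr0 addr0 in ey0 ex0; rewrite e1 mulr1 in ey1 ex1.
have /andP[y0_ge0 _] := in01 y0; have /andP[_ y1_le1] := in01 y1.
have /andP[x0_ge0 _] := in01 x0; have /andP[_ x1_le1] := in01 x1.
have dy0 : 0 <= d * val y0 by rewrite mulr_ge0 // ltW.
have bx0 : 0 <= b * val x0 by rewrite mulr_ge0 // ltW.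
have dy1 : d * val y1 <= d by rewrite ler_piMr // ltW.
have bx1 : b * val x1 <= b by rewrite ler_piMr // ltW.
by split; lra.
Qed.

(** The affine maps allowed in the definition of 2V have no freedom: on a
    rectangle, a map of the given form onto another rectangle is the standard
    one, because each coordinate is increasing. *)
Lemma is_h_carries n (r1 r2 : 'I_n -> rect) f i :
  is_h r1 r2 f -> carries f (r1 i) (r2 i).
Proof.
move=> /(_ i); move: (r1 i) (r2 i) => r r' [fr [a [b [j [k fE]]]]].
have fpE p : val (f (place r p)).1 = a + 3 ^ j * val (place1 r.1 p.1) /\
             val (f (place r p)).2 = b + 3 ^ k * val (place1 r.2 p.2).
  by apply: fE; exists p.
have into p : exists p', f (place r p) = place r' p'.
  have : region r' (f (place r p)) by rewrite -fr; exists (place r p) => //; exists p.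
  by case=> p' _ <-; exists p'.
have onto p' : exists p, f (place r p) = place r' p'.
  have : region r' (place r' p') by exists p'.
  by rewrite -fr => -[_ [p _ <-] <-]; exists p.
have pos3 (z : int) : (0 : R) < 3 ^ z by apply: exprz_gt0; lra.
have pos3V m : (0 : R) < 3 ^- m by rewrite invr_gt0 exprn_gt0 //; lra.
pose o : cantor R := cantor_end false.
have [e1 e2] : (a + 3 ^ j * val (place1 r.1 o) = val (place1 r'.1 o)) /\
   (3 ^ j * 3 ^- size r.1 = 3 ^- size r'.1 :> R).
  apply: affine_cantor_onto => [||x|y]; rewrite ?mulr_gt0 //.
    have [p' e] := into (x, o); exists p'.1; rewrite -val_place1.
    have [+ _] := fpE (x, o); rewrite e /= => ->.
    by rewrite [in RHS]val_place1 mulrDr !mulrA addrA.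
  have [[x x'] e] := onto (y, o); exists x; rewrite -val_place1.
  have [+ _] := fpE (x, x'); rewrite e /= => ->.
  by rewrite [in RHS]val_place1 mulrDr !mulrA addrA.
have [e3 e4] : (b + 3 ^ k * val (place1 r.2 o) = val (place1 r'.2 o)) /\
   (3 ^ k * 3 ^- size r.2 = 3 ^- size r'.2 :> R).
  apply: affine_cantor_onto => [||x|y]; rewrite ?mulr_gt0 //.
    have [p' e] := into (o, x); exists p'.2; rewrite -val_place1.
    have [_ +] := fpE (o, x); rewrite e /= => ->.
    by rewrite [in RHS]val_place1 mulrDr !mulrA addrA.
  have [[x' x] e] := onto (o, y); exists x; rewrite -val_place1.
  have [_ +] := fpE (x', x); rewrite e /= => ->.
  by rewrite [in RHS]val_place1 mulrDr !mulrA addrA.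
move=> p; have [f1 f2] := fpE p.
rewrite [LHS]surjective_pairing; congr pair; apply: val_inj.
  by rewrite f1 val_place1 mulrDr addrA e1 mulrA e2 -val_place1.
by rewrite f2 val_place1 mulrDr addrA e3 mulrA e4 -val_place1.
Qed.

Lemma carries_is_h n (r1 r2 : 'I_n -> rect) f :
  (forall i, carries f (r1 i) (r2 i)) -> is_h r1 r2 f.
Proof.
move=> + i => /(_ i); move: (r1 i) (r2 i) => r r' fr; split.
  apply/seteqP; split=> [_ [_ [p _ <-] <-]|_ [p _ <-]]; first by exists p.
  by exists (place r p) => //; exists p.
pose o : cantor R := cantor_end false.
pose z (u u' : seq bool) : int := (size u)%:Z - (size u')%:Z.
have zE u u' : 3 ^ z u u' * 3 ^- size u = 3 ^- size u' :> R.
  rewrite /z !exprnN -!expfzDr ?pnatr_eq0 //.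
  by congr (_ ^ _); lia.
exists (val (place1 r'.1 o) - 3 ^ z r.1 r'.1 * val (place1 r.1 o)),
       (val (place1 r'.2 o) - 3 ^ z r.2 r'.2 * val (place1 r.2 o)),
       (z r.1 r'.1), (z r.2 r'.2).
move=> _ [p _ <-]; rewrite fr /=; split.
  rewrite (val_place1 r'.1 p.1) -(zE r.1) (val_place1 r.1 p.1) -/o /=; ring.
rewrite (val_place1 r'.2 p.2) -(zE r.2) (val_place1 r.2 p.2) -/o /=; ring.
Qed.

End Affine.

(** * Refinement of patterns, and closure of 2V under composition *)

(** A way of cutting a rectangle, which can be transported to other rectangles. *)
Inductive btree := Leaf | Node of bisection & btree & btree.

Fixpoint leaves t r : set rect :=
  match t with
  | Leaf => [set r]
  | Node d a b => leaves a (half d false r) `|` leaves b (half d true r)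
  end.

Lemma leaves_extend t r q : leaves t r q -> exists e, q = extend r e.
Proof.
elim: t r => [|d a IHa b IHb] r /=.
  by move=> ->; exists whole; rewrite extend_whole.
by move=> [/IHa|/IHb] [e ->]; rewrite half_extend -extendA; eexists.
Qed.

Fixpoint slice d n t := if n is n'.+1 then Node d (slice d n' t) (slice d n' t) else t.

Definition grid n m := slice Vertical n (slice Horizontal m Leaf).

Lemma leaves_slice d n t r q : leaves (slice d n t) r q <->
  exists2 u, size u = n & leaves t (if d is Vertical then (r.1 ++ u, r.2)
                                    else (r.1, r.2 ++ u)) q.
Proof.
elim: n r => [|n IH] r /=.
  split=> [rq|[u /size0nil ->]].
    by exists [::] => //; case: d r rq => -[u w]; rewrite /= cats0.
  by case: d r => -[u' w']; rewrite /= cats0.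
split=> [[/IH[u <- uq]|/IH[u <- uq]]|[[//|b u] [un] uq]].
- by exists (false :: u) => //; case: d uq {IH}; rewrite /= cat_rcons.
- by exists (true :: u) => //; case: d uq {IH}; rewrite /= cat_rcons.
- case: b uq => uq; [right|left]; apply/IH; exists u => //;
    by case: d uq {IH}; rewrite /= cat_rcons.
Qed.

Lemma leaves_grid n m r q : leaves (grid n m) r q <->
  exists e, [/\ size e.1 = n, size e.2 = m & q = extend r e].
Proof.
split.
  move=> /leaves_slice[u un] /leaves_slice[w wm] /= ->; by exists (u, w).
move=> [[u w] [/= un wm ->]]; apply/leaves_slice; exists u => //.
by apply/leaves_slice; exists w.
Qed.

Lemma half_neq d r e : extend (half d false r) e <> half d true r.
Proof.
case: d => [/(congr1 (fun q : rect => nth false q.1 (size r.1)))|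
            /(congr1 (fun q : rect => nth false q.2 (size r.2)))] /=;
  by rewrite nth_cat size_rcons leqnn !nth_rcons ltnn eqxx.
Qed.

Section Refinement.
Context {R : realType}.
Implicit Types (f g : homeo (cantor2 R)) (r q : rect) (P Q : set rect).

(** The two subtrees are grafted one after the other; the second half of r is still
    a rectangle of the pattern when its turn comes. *)
Lemma pattern_graft P r t : pattern P -> P r -> pattern (P `\ r `|` leaves t r).
Proof.
elim: t P r => [|d a IHa b IHb] P r PP Pr /=; first by rewrite setDKU // => q ->.
have halves := PatternBisect d PP Pr.
have ra : (P `\ r `|` [set half d false r; half d true r]) (half d false r).
  by right; left.
have := IHa _ _ halves ra.
set P2 := _ `|` leaves a _ => PP2.
have rb : P2 (half d true r).
  left; split; first by right; right.
  by move=> /esym; rewrite /= -[half d false r]extend_whole; exact: half_neq.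
have := IHb _ _ PP2 rb.
rewrite (_ : _ `\ _ `|` leaves b _ =
  P `\ r `|` (leaves a (half d false r) `|` leaves b (half d true r))) //.
apply/seteqP; split=> q.
- by move=> [[[[[[Pq qr]|[e|e]] q0]|aq] q1]|bq] /=; tauto.
- have notP b' : P q -> q <> half d b' r.
    by move=> Pq qr; apply: (@half_notin R P d b' r) => //; rewrite -qr.
  move=> [[Pq qr]|[aq|bq]].
  + left; split; last exact: notP.
    by left; split; [left|exact: notP].
  + left; split; first by right.
    have [e ->] := leaves_extend aq; exact: half_neq.
  + by right.
Qed.

(** Replacing r by its halves in P and then cutting these is the same as cutting r
    by a larger tree, so the choice of trees on a bisected pattern reduces to a
    choice on the previous one. *)
Lemma pattern_refine P (k : rect -> btree) : pattern P ->
  pattern [set q | exists2 r, P r & leaves (k r) r q].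
Proof.
move=> PP; suff [t ->] : exists t,
    [set q | exists2 r, P r & leaves (k r) r q] = leaves t whole.
  by have := pattern_graft t PatternWhole (erefl whole); rewrite setDv set0U.
elim: PP k => {P} [|P r d _ IH Pr] k.
  by exists (k whole); apply/seteqP; split=> [q [_ ->]|q kq] //; exists whole.
have [t te] := IH (fun q => if q == r then Node d (k (half d false r)) (k (half d true r))
                          else k q).
exists t; rewrite -te; apply/seteqP; split=> q.
  move=> [s [[Ps /eqP/negPf sr]|[]->] sq]; first by exists s; rewrite ?sr.
    by exists r; rewrite // eqxx; left.
  by exists r; rewrite // eqxx; right.
move=> [s Ps]; case: eqP => [->|sr].
  by move=> [kq|kq]; [exists (half d false r)|exists (half d true r)] => //;
    right; [left|right].
by exists s => //; left.
Qed.

Lemma place1_prefix u w (x y : cantor R) : (size u <= size w)%N ->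
  place1 u x = place1 w y -> exists z, w = u ++ z.
Proof.
elim: u w x => [|b u IH] [|c w] x //= uw; [by exists [::]|by exists (c :: w)|].
by move=> /cthird_eq[<-] /(IH _ _ uw)[z ->]; exists z.
Qed.

(** The regions of P cover C x C, and a rectangle whose address is not longer than
    that of q meets q only if its address is a prefix of that of q. *)
Lemma pattern_address P q : pattern P ->
    (forall r, P r -> (size r.1 <= size q.1)%N && (size r.2 <= size q.2)%N) ->
  exists2 r, P r & exists e, q = extend r e.
Proof.
move=> PP Pq; pose p : cantor2 R := (cantor_end false, cantor_end false).
have [r Pr [p' _ e]] := pattern_cover (place q p) PP; exists r => //.
have /andP[r1q r2q] := Pq r Pr.
have [u eu] := place1_prefix r1q (congr1 fst e).
have [w ew] := place1_prefix r2q (congr1 snd e).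
by exists (u, w); rewrite /extend /= -eu -ew -surjective_pairing.
Qed.

Lemma pattern_bounded P : pattern P ->
  exists N, forall r, P r -> (size r.1 <= N)%N && (size r.2 <= N)%N.
Proof.
elim=> {P} [|P r d _ [N PN] Pr]; first by exists 0%N => r ->.
exists N.+1 => q [[/PN/andP[qN qN'] _]|]; first by rewrite !leqW.
have /andP[rN rN'] := PN r Pr.
by case: d => -[|]-> /=; rewrite size_rcons ?ltnS ?rN ?rN' ?leqW.
Qed.

(** A form of the definition of 2V without numberings, in which f and its inverse
    play symmetric parts. *)
Definition maps_pattern f P P' :=
  (forall r, P r -> exists2 r', P' r' & carries f r r') /\
  (forall r', P' r' -> exists2 r, P r & carries f r r').

Lemma maps_patternV f P P' : maps_pattern f P P' -> maps_pattern (homeoV f) P' P.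
Proof.
have carriesV r r' : carries f r r' -> carries (homeoV f) r' r.
  by move=> fr p; rewrite -fr; exact: homeoK.
by move=> [fP fP']; split=> r => [/fP'|/fP] [r' Pr' /carriesV]; exists r'.
Qed.

Lemma maps_patternM f g P P' P'' :
  maps_pattern f P P' -> maps_pattern g P' P'' -> maps_pattern (homeoM g f) P P''.
Proof.
have carriesM r r' r'' :
    carries f r r' -> carries g r' r'' -> carries (homeoM g f) r r''.
  by move=> fr gr p /=; rewrite fr gr.
move=> [fP fP'] [gP gP']; split.
  move=> r /fP[r' /gP[r'' Pr'' gr] fr]; exists r'' => //; exact: carriesM gr.
move=> r'' /gP'[r' /fP'[r Pr fr] gr]; exists r => //; exact: carriesM gr.
Qed.

Lemma carries_extend f r r' e :
  carries f r r' -> carries f (extend r e) (extend r' e).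
Proof. by move=> fr p; rewrite !place_extend fr. Qed.

Lemma carries_inj P f r q r' : pattern P -> P r -> P q ->
  carries f r r' -> carries f q r' -> r = q.
Proof.
move=> PP Pr Pq fr fq; pose p : cantor2 R := (cantor_end false, cantor_end false).
have e : place r p = place q p by apply: (can_inj (homeoK f)); rewrite fr fq.
by apply: (@pattern_disjoint R P _ _ (place r p)) => //; [exists p|rewrite e; exists p].
Qed.

Definition grid_set N : set rect := [set q | size q.1 = N /\ size q.2 = N].

(** Each rectangle of P is cut into the small rectangles of the grid that it
    contains, and its image in P' is cut in the same way. *)
Lemma maps_pattern_grid f P P' N : pattern P -> pattern P' ->
    (forall r, P r -> (size r.1 <= N)%N && (size r.2 <= N)%N) ->
    maps_pattern f P P' ->
  exists2 S, pattern S & maps_pattern f (grid_set N) S.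
Proof.
move=> PP PP' PN [fP fP'].
have [pre preP] : exists pre : rect -> rect, forall r', P' r' ->
    P (pre r') /\ carries f (pre r') r'.
  suff /choice[pre preP] : forall r', exists r, P' r' -> P r /\ carries f r r'.
    by exists pre.
  move=> r'; have [/fP'[r Pr fr]|nP] := pselect (P' r'); first by exists r.
  by exists r'.
pose k r' := grid (N - size (pre r').1) (N - size (pre r').2).
exists [set q | exists2 r', P' r' & leaves (k r') r' q]; first exact: pattern_refine.
split=> [q [q1N q2N]|q' [r' Pr' /leaves_grid[e [e1 e2 ->]]]].
  have [|r Pr [e eq]] := @pattern_address P q PP.
    by move=> r /PN; rewrite q1N q2N.
  have [r' Pr' fr] := fP r Pr.
  exists (extend r' e); last by rewrite eq; exact: carries_extend.
  exists r' => //; apply/leaves_grid; exists e; split=> //.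
  - have [Ppre fpre] := preP r' Pr'; rewrite -(carries_inj PP Pr Ppre fr fpre).
    by rewrite -q1N eq /= size_cat addKn.
  - have [Ppre fpre] := preP r' Pr'; rewrite -(carries_inj PP Pr Ppre fr fpre).
    by rewrite -q2N eq /= size_cat addKn.
have [Ppre fpre] := preP r' Pr'; have /andP[? ?] := PN _ Ppre.
exists (extend (pre r') e); last exact: carries_extend.
by split; rewrite /= size_cat ?e1 ?e2 subnKC.
Qed.

Lemma maps_pattern_list f P P' s : pattern P -> pattern P' ->
    maps_pattern f P P' -> uniq s -> P = [set` s] ->
  exists phi, [/\ uniq (map phi s), P' = [set` map phi s] &
    forall r, P r -> carries f r (phi r)].
Proof.
move=> PP PP' [fP fP'] us Ps.
have [phi phiP] : exists phi : rect -> rect, forall r, P r ->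
    P' (phi r) /\ carries f r (phi r).
  suff /choice[phi phiP] : forall r, exists r', P r -> P' r' /\ carries f r r'.
    by exists phi.
  move=> r; have [/fP[r' Pr' fr]|nP] := pselect (P r); first by exists r'.
  by exists r.
exists phi; split=> [||r /phiP[]//].
- rewrite map_inj_in_uniq // => r q rs qs e.
  have [Pr Pq] : P r /\ P q by rewrite Ps.
  have [_ fr] := phiP r Pr; have [_ fq] := phiP q Pq.
  by rewrite -e in fq; exact: (carries_inj PP Pr Pq fr fq).
- apply/seteqP; split=> [r' Pr'|_ /= /mapP[r rs ->]].
    have [r Pr fr] := fP' r' Pr'; have [Pphi fphi] := phiP r Pr.
    apply/mapP; exists r; first by move: Pr; rewrite Ps.
    apply: (@carries_inj P' (homeoV f) r' (phi r) r) => // p.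
      by rewrite -fr; exact: homeoK.
    by rewrite -fphi; exact: homeoK.
  by have [] := phiP r; rewrite // Ps.
Qed.

Lemma numbering_list P s : uniq s -> P = [set` s] ->
  numbering P (fun i : 'I_(size s) => nth whole s i).
Proof.
move=> us ->; split=> [i _|i j _ _ /eqP|q /= /nthP-/(_ whole)[i si <-]].
- exact: mem_nth.
- by rewrite nth_uniq // => /eqP/val_inj.
- by exists (Ordinal si).
Qed.

Lemma twoVP f : twoV f <->
  exists P P', [/\ pattern P, pattern P' & maps_pattern f P P'].
Proof.
split=> [[n [P [P' [r1 [r2 [PP PP' n1 n2 fh]]]]]]|[P [P' [PP PP' fPP']]]].
  exists P, P'; split=> //; split=> r.
    have [_ _ /[apply] -[i _ <-]] := n1; exists (r2 i); last exact: is_h_carries.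
    by have [+ _ _] := n2; exact.
  have [_ _ /[apply] -[i _ <-]] := n2; exists (r1 i); last exact: is_h_carries.
  by have [+ _ _] := n1; exact.
have [g [s [_ us Ps]]] := @pattern_spelled R P PP.
have [phi [ut P't fphi]] := maps_pattern_list PP PP' fPP' us Ps.
exists (size s), P, P', (fun i => nth whole s i), (fun i => phi (nth whole s i)).
split=> //; first exact: numbering_list.
- have := numbering_list ut P't; rewrite size_map; congr numbering.
  by apply/funext => i; rewrite (nth_map whole).
- by apply: carries_is_h => i; apply: fphi; rewrite Ps /=; exact: mem_nth.
Qed.

(** Refine the target of f and the source of g to a common grid. *)
Lemma twoVM f g : twoV f -> twoV g -> twoV (homeoM g f).
Proof.
move=> /twoVP[P [P' [PP PP' fP]]] /twoVP[Q [Q' [PQ PQ' gQ]]]; apply/twoVP.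
have [N P'N] := pattern_bounded PP'; have [M QM] := pattern_bounded PQ.
have le_max r K : (K <= maxn N M)%N ->
    (size r.1 <= K)%N && (size r.2 <= K)%N ->
    (size (r : rect).1 <= maxn N M)%N && (size r.2 <= maxn N M)%N.
  by move=> KNM /andP[r1 r2]; rewrite !(leq_trans _ KNM).
have [|S PS fS] := @maps_pattern_grid (homeoV f) P' P (maxn N M) PP' PP _
  (maps_patternV fP).
  by move=> r /P'N; apply: le_max; exact: leq_maxl.
have [|T PT gT] := @maps_pattern_grid g Q Q' (maxn N M) PQ PQ' _ gQ.
  by move=> r /QM; apply: le_max; exact: leq_maxr.
exists S, T; split=> //; apply: maps_patternM gT.
by have := maps_patternV fS; congr maps_pattern; exact: homeoP.
Qed.

Lemma twoVV f : twoV f -> twoV (homeoV f).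
Proof.
move=> /twoVP[P [P' [PP PP' /maps_patternV fP]]]; apply/twoVP.
by exists P', P.
Qed.

Lemma twoV1 : twoV (@homeo1 (cantor2 R)).
Proof.
apply/twoVP; exists [set whole], [set whole].
by split; [exact: PatternWhole..|split=> r; exists r].
Qed.

End Refinement.

(** * Elements of 2V as quotients of words *)

Section TwoV.
Context {R : realType}.
Implicit Types (f : homeo (cantor2 R)) (g : homeo (Yspace R)).

(** A homeomorphism of Y fixing every point outside S_0 maps S_0 onto itself, by
    injectivity. *)
Lemma on_S0_of g : (forall i p, g (i.+1, p) = (i.+1, p)) ->
  exists f, on_S0 f = g.
Proof.
move=> gS.
have stays (k : homeo (Yspace R)) : (forall i p, k (i.+1, p) = (i.+1, p)) ->
    forall p, k (0%N, p) = (0%N, (k (0%N, p)).2).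
  move=> kS p; case e : (k (0%N, p)) => [[|i] q] //.
  by move: e; rewrite -(kS i q) => /(can_inj (homeoK k)).
have gVS i p : homeoV g (i.+1, p) = (i.+1, p).
  by rewrite -{1}(gS i p); exact: homeoK.
pose restr (k : homeo (Yspace R)) p := (k (0%N, p)).2.
have restrK (k l : homeo (Yspace R)) : (forall i p, k (i.+1, p) = (i.+1, p)) ->
    cancel k l -> cancel (restr k) (restr l).
  by move=> kS kl p; rewrite /restr -stays // kl.
have restr_cont k : continuous (restr k).
  move=> p; apply: (@continuous_comp _ _ _ (fun p => k (0%N, p)) snd).
    apply: (@continuous_comp _ _ _ (fun p => (0%N, p)) k).
      by apply: pair_continuous; [exact: cst_continuous|move=> x; exact: cvg_id].
    exact: homeo_continuous.
  exact: cvg_snd.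
exists (Homeo (restrK g (homeoV g) gS (homeoK g))
  (restrK (homeoV g) g gVS (homeo_invK g)) (restr_cont g) (restr_cont (homeoV g))).
apply: homeoP => -[[|i] p]; rewrite /= /on_S0_fun /=; last by rewrite gS.
by rewrite [RHS]stays.
Qed.

Lemma on_S0_spelled f g1 g2 s1 s2 : size s1 = size s2 -> (0 < size s1)%N ->
    coded g1 (list_code s1) -> coded g2 (list_code s2) ->
    (forall i, (i < size s1)%N -> carries f (nth whole s1 i) (nth whole s2 i)) ->
  (on_S0 f * g1)%g = g2.
Proof.
move=> s12 s1_gt0 cg1 cg2 fs; apply: homeoP => -[n p].
rewrite [LHS]/= cg1 cg2 /act /list_code /on_S0_fun -s12 /=.
case: ltnP => ns /=; first by rewrite fs.
by case e : (n - _)%N => //; lia.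
Qed.

(** Two words with equally many bisections shift the undivided squares equally, so
    their quotient is supported in S_0, where it carries one pattern to the
    other. *)
Lemma word_quotient m g1 g2 : word m g1 -> word m g2 -> twoV_Y (g2 / g1)%g.
Proof.
move=> /word_pattern[s1 [ss1 us1 Ps1 cg1]] /word_pattern[s2 [ss2 us2 Ps2 cg2]].
have gE y : (g2 / g1)%g (g1 y) = g2 y.
  by rewrite -[LHS]/((g2 / g1 * g1)%g y) mulgVK.
have [i p|f fE] := @on_S0_of (g2 / g1)%g.
  have tail g s : size s = m.+1 -> coded g (list_code s) ->
      g ((i.+1 + m)%N, p) = (i.+1, p).
    move=> ss cg; rewrite cg /act /list_code ss.
    have -> : (i.+1 + m < m.+1)%N = false by lia.
    by rewrite addnK; case: p.
  by rewrite -{1}(tail g1 s1) // gE (tail g2 s2).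
exists f => //; apply/twoVP; exists [set` s1], [set` s2]; split=> //.
have fs n : (n < m.+1)%N -> carries f (nth whole s1 n) (nth whole s2 n).
  move=> nm p; have := gE (n, p); rewrite -fE cg1 cg2 /act /list_code ss1 ss2 nm.
  by move=> /(congr1 snd).
split=> r /= /(nthP whole)[i]; rewrite ?ss1 ?ss2 => im <-;
  [exists (nth whole s2 i)|exists (nth whole s1 i)];
  rewrite /= ?mem_nth ?ss1 ?ss2 //; exact: fs.
Qed.

Lemma twoV_Y_subgroup : subgroup (@twoV_Y R).
Proof.
split=> [|_ _ [f fV <-] [g gV <-]|_ [f fV <-]].
- exists homeo1; first exact: twoV1.
  by apply: homeoP => -[[|i] p].
- exists (homeoM f g); first exact: twoVM.
  by apply: homeoP => -[[|i] p].
- exists (homeoV f); first exact: twoVV.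
  by apply: homeoP => -[[|i] p].
Qed.

Lemma word_v0 n : word n (v R 0 ^+ n)%g.
Proof.
elim: n => [|n IH]; first exact: word_nil.
by rewrite expgSr; exact: (word_bis Vertical).
Qed.

Lemma generators_twoV :
  \bigcup_(i < 2) [set A R i; B R i; pi_ R i; pibar R i] `<=` @twoV_Y R.
Proof.
move=> x [i _] [[[]|]|] ->.
- apply: (@word_quotient i.+2 (v R 0 ^+ i.+2)%g); first exact: word_v0.
  exact: (word_bis Vertical (isT : 1 <= i.+1)%N (word_v0 _)).
- apply: (@word_quotient i.+2 (v R 0 ^+ i.+2)%g); first exact: word_v0.
  exact: (word_bis Horizontal (isT : 1 <= i.+1)%N (word_v0 _)).
- apply: (@word_quotient i.+2 (v R 0 ^+ i.+2)%g); first exact: word_v0.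
  exact: (word_sigma (isT : 2 <= i.+2)%N (word_v0 _)).
- apply: (@word_quotient i.+1 (v R 0 ^+ i.+1)%g); first exact: word_v0.
  exact: (word_sigma (isT : 1 <= i.+1)%N (word_v0 _)).
Qed.

End TwoV.

Theorem proposition6p2 (R : realType) :
  @twoV_Y R =
  generated (\bigcup_(i < 2) [set A R i; B R i; pi_ R i; pibar R i]).
Proof.
set S := \bigcup_(i < 2) _.
apply/seteqP; split=> [_ [f /twoVP[P [P' [PP PP' fP]]] <-]|x Sx]; last first.
  exact: (Sx _ (conj twoV_Y_subgroup generators_twoV)).
have [g1 [s [[w1 c1] us Ps]]] := @pattern_spelled R P PP.
have [phi [ut P't fphi]] := maps_pattern_list PP PP' fP us Ps.
have [g [t [gt u't Pt]]] := @pattern_spelled R P' PP'.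
have [|g2 [w2 c2]] := spells_perm gt (_ : perm_eq t (map phi s)).
  apply: uniq_perm => // q; have := P't; rewrite Pt => /seteqP[tq qt].
  by apply/idP/idP; [exact: tq|exact: qt].
rewrite size_map in w2.
have s_gt0 : (0 < size s)%N.
  have [r] := @pattern_cover R P (cantor_end false, cantor_end false) PP.
  by rewrite Ps; case: (s).
have e : (on_S0 f * g1 = g2)%g.
  apply: on_S0_spelled c1 c2 _; rewrite ?size_map // => i si.
  by rewrite (nth_map whole) //; apply: fphi; rewrite Ps /=; exact: mem_nth.
move=> H [H_subgroup SH]; case: (H_subgroup) => _ HM HV.
have -> : on_S0 f = (vfrac 0 g2 (size s).-1 * (vfrac 0 g1 (size s).-1)^-1)%g.
  by rewrite vfracV vfracM -e /vfrac expg0 mul1g invg1 mulg1 mulgK.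
by apply: HM; [|apply: HV]; exact: vfrac_word_gen.
Qed.
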